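(* Let $d\ge2$ be an integer, let $0\le m\le n$ be integers, $1\le l\le\dim\mathcal H_m^d$, and let $p$ be real with $p>2n+d$. Then $S_{n,m,l}^{p,N}$ satisfies the difference-differential equation $$t^2\frac{\partial^2}{\partial t^2}\left[S_{n,m,l}^{p,N}\right]+(1-p+d)\,t\,\frac{\partial}{\partial t}\left[S_{n,m,l}^{p,N}\right]=n(n-p+d)\,S_{n,m,l}^{p,N}+(m-n)(p-n-m-d)\,S_{n-1,m,l}^{p-2,N},$$ where the last term is read as $0$ when $m=n$.
   Context: Univariate polynomials: $N_n^{(p)}(x)=(-1)^nx^pe^{1/x}\frac{d^n}{dx^n}\left(x^{-p+2n}e^{-1/x}\right)$, a polynomial of degree at most $n$ in $x$. $\mathcal H_m^d$ is the space of harmonic homogeneous polynomials of degree $m$ in $d$ variables, and $\{Y_l^m:1\le l\le\dim\mathcal H_m^d\}$ is a fixed orthonormal basis of it in $L^2$ of the unit sphere $\mathbb S^{d-1}$ with normalized surface measure. For $0\le m\le n$, $$S_{n,m,l}^{p,N}(x,t)=N_{n-m}^{(p-2m-d+1)}(t)\,Y_l^m(x)$$ (the superscript $N$ is a label), considered on the surface of the cone $\mathbb V_0^{d+1}=\{(x,t):\|x\|=t,\ x\in\mathbb R^d,\ 0\le t<\infty\}$. The equation is understood in the coordinates $(\xi,t)$ with $x=t\xi$, $\xi\in\mathbb S^{d-1}$: $S_{n,m,l}^{p,N}$ is viewed as the function $(\xi,t)\mapsto S_{n,m,l}^{p,N}(t\xi,t)=N_{n-m}^{(p-2m-d+1)}(t)\,t^mY_l^m(\xi)$,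 and $\frac{\partial}{\partial t}$ is the derivative in $t$ with $\xi$ fixed. *)

(* Defs.v *)
From mathcomp Require Import all_boot all_order all_algebra.
From mathcomp Require mpoly.
(* The notations of mpoly clash with those of mathcomp-analysis. *)
Import -(notations) mpoly.
From mathcomp Require Import all_classical all_reals all_analysis.

Set Implicit Arguments.
Unset Strict Implicit.
Unset Printing Implicit Defensive.

Import Order.TTheory GRing.Theory Num.Theory.
Import numFieldNormedType.Exports.

Local Open Scope classical_set_scope.
Local Open Scope ring_scope.

Definition rodrigues (R : realType) (n : nat) (p x : R) : R :=
  (-1) ^+ n * x `^ p * expR (x^-1) *
  derive1n n (fun y : R => y `^ (- p + 2 * n%:R) * expR (- y^-1)) x.

(* The Rodrigues formula only makes sense for x > 0, where it coincides with a
   polynomial, necessarily unique; taking that polynomial gives the value at 0,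
   i.e. at the apex of the cone. *)
Definition Npoly (R : realType) (n : nat) (p : R) : {poly R} :=
  xget 0 [set q : {poly R} | forall x : R, 0 < x -> q.[x] = rodrigues n p x].

(* The library norm on row vectors is the sup norm. *)
Definition enorm (R : realType) (d : nat) (x : 'rV[R]_d) : R :=
  Num.sqrt (\sum_(i < d) x 0 i ^+ 2).

(* Lebesgue integral over R^d, as an iterated integral.  It is only used for
   bounded Borel functions with bounded support, for which this is Fubini. *)
Fixpoint lebesgue_int (R : realType) (d : nat) : ('rV[R]_d -> R) -> R :=
  match d with
  | 0 => fun f => f 0
  | d'.+1 => fun f =>
      Rintegral (@lebesgue_measure R) setT
        (fun a : R => lebesgue_int (fun x : 'rV[R]_d' =>
           f (row_mx (const_mx a : 'rV[R]_1) x)))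
  end.

Definition unit_ball_int (R : realType) (d : nat) (f : 'rV[R]_d -> R) : R :=
  lebesgue_int (fun x => if enorm x <= 1 then f x else 0).

(* Integral against the normalized surface measure of the unit sphere: the
   measure of A is vol {r xi | xi in A, 0 < r <= 1} / vol (unit ball). *)
Definition sphere_int (R : realType) (d : nat) (f : 'rV[R]_d -> R) : R :=
  unit_ball_int (fun x => f ((enorm x)^-1 *: x)) /
  unit_ball_int (fun _ : 'rV[R]_d => 1).

Definition peval (R : realType) (d : nat) (q : mpoly d R) (x : 'rV[R]_d)
  : R := meval (fun i => x 0 i) q.

Definition laplacian (R : realType) (d : nat) (q : mpoly d R)
  : mpoly d R :=
  \sum_(i < d) mderiv i (mderiv i q).

Definition harmonic_homog (R : realType) (d m : nat) (q : mpoly d R)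
  : Prop :=
  q \is ishomog1 m mdeg /\ laplacian q = 0.

(* In particular N is the dimension of the space of harmonic homogeneous
   polynomials of degree m in d variables. *)
Definition harmonic_orthonormal_basis (R : realType) (d m N : nat)
    (Y : 'I_N -> mpoly d R) : Prop :=
  [/\ forall l, harmonic_homog m (Y l),
      forall k l, sphere_int (fun xi => peval (Y k) xi * peval (Y l) xi)
                  = (k == l)%:R
    & forall q, harmonic_homog m q ->
        exists c : 'I_N -> R, q = \sum_(l < N) c l *: Y l].

(* On the cone, enorm x = t; the formula is polynomial, hence extends to all x and
   t, and along x = t xi its t-derivatives at the apex are those from t >= 0. *)
Definition coneS (R : realType) (d : nat) (p : R) (n m : nat)
    (Yml : mpoly d R) (x : 'rV[R]_d) (t : R) : R :=
  (Npoly (n - m) (p - 2 * m%:R - d%:R + 1)).[t] * peval Yml x.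

Definition cone_coord (R : realType) (d : nat) (f : 'rV[R]_d -> R -> R)
    (xi : 'rV[R]_d) (t : R) : R :=
  f (t *: xi) t.

(* Main.v *)
(* Write N_k^(q) = (-1)^k g_k, where g_j is the polynomial factor of the j-th
   derivative of y^b e^(-1/y), b = 2k - q.  Since b is unchanged under
   (k, q) -> (k - 1, q - 2), the polynomial N_(k-1)^(q-2) is -(-1)^k g_(k-1), built
   from the same sequence.  The Leibniz rule gives
   g_(j+1) = (1 + (b - 2j) x) g_j + x^2 g_j', and then, by induction,
   g_j' = j (b - j + 1) g_(j-1).  These two relations yield the theorem, the
   factor t^m Y(xi) of S being absorbed by conjugating the Euler operator t d/dt. *)
Require Import Defs.
From mathcomp Require Import all_boot all_order all_algebra.
From mathcomp Require mpoly.
Import -(notations) mpoly.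
From mathcomp Require Import all_classical all_reals all_analysis.
From mathcomp Require Import ring.
Import Order.TTheory GRing.Theory Num.Theory.
Import numFieldNormedType.Exports.
Local Open Scope classical_set_scope.
Local Open Scope ring_scope.

Fixpoint rodrigues_factor (R : comNzRingType) (b : R) (j : nat) : {poly R} :=
  if j is i.+1 then
    (1 + (b - 2 * i%:R)%:P * 'X) * rodrigues_factor R b i
    + 'X^2 * (rodrigues_factor R b i)^`()
  else 1.
Arguments rodrigues_factor {R} b j.

Lemma deriv_rodrigues_factor (R : comNzRingType) (b : R) (j : nat) :
  (rodrigues_factor b j.+1)^`()
    = (j.+1%:R * (b - j%:R))%:P * rodrigues_factor b j.
Proof.
have : rodrigues_factor b 0 = 1 by [].
have : forall i, rodrigues_factor b i.+1
    = (1 + (b - 2 * i%:R)%:P * 'X) * rodrigues_factor b i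
      + 'X^2 * (rodrigues_factor b i)^`() by [].
(* Abstracting the sequence keeps the rewrites from unfolding it. *)
move: (rodrigues_factor b) => g gS g0.
elim: j => [|j IHj].
  rewrite gS g0 !(derivM, derivD, derivC, derivX) !(rmorphM, rmorphB) /=; ring.
(* [IHj] removes the derivatives of [g j.+1]; the last [gS] then expresses both sides through [g j]
   and its derivative. *)
rewrite gS !(derivM, derivD) IHj !(derivM, derivC, derivXn, derivX) gS.
rewrite -!natr1 !(rmorphM, rmorphD, rmorphB) /= !rmorph_nat.
ring.
Qed.

(** The derivative of -1/x brings out x^(-2), so x^(a-2) is the common power; x^(a-1) and x^a
    contribute the extra x and x^2, which gives one step of the recursion. *)
Lemma is_derive_powR_expRNV (R : realType) (a : R) (g : {poly R}) (x : R) :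
  0 < x ->
  is_derive x 1 (fun y => y `^ a * g.[y] * expR (- y^-1))
    (x `^ (a - 2) * ((1 + a%:P * 'X) * g + 'X^2 * g^`()).[x] * expR (- x^-1)).
Proof.
move=> x0; have xN0 : x != 0 by rewrite gt_eqF.
have dpow := is_derive1_powR a x0.
have dg := is_derive_poly g x.
have dV : is_derive x 1 (fun y : R => - y^-1) (x ^- 2).
  apply: is_derive_eq (is_deriveN (is_deriveV xN0 (is_derive_id x 1))) _.
  by rewrite scaleNr opprK [_ *: _]mulr1.
have dexp := @is_derive1_comp _ _ (fun y => - y^-1) _ _ _ (is_derive_expR _) dV.
apply: is_derive_eq (is_deriveM (is_deriveM dpow dg) dexp) _.
rewrite -[(_ * horner g) x]/(x `^ a * g.[x]).
have -> : x `^ (a - 1) = x `^ (a - 2) * x.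
  by rewrite -{3}(powRr1 (ltW x0)) -powRD ?xN0 ?implybT//; congr (_ `^ _); ring.
have -> : x `^ a = x `^ (a - 2) * x ^+ 2.
  by rewrite -powR_mulrn ?ltW// -powRD ?xN0 ?implybT//; congr (_ `^ _); ring.
rewrite /GRing.scale /= !(hornerE, hornerXn) /=; field.
exact: xN0.
Qed.

Lemma derive1n_powR_expRNV (R : realType) (b : R) (j : nat) (x : R) :
  0 < x ->
  derive1n j (fun y : R => y `^ b * expR (- y^-1)) x
    = x `^ (b - 2 * j%:R) * (rodrigues_factor b j).[x] * expR (- x^-1).
Proof.
elim: j x => [|j IHj] x x0.
  by rewrite derive1n0 /= hornerC mulr1 mulr0 subr0.
have -> : b - 2 * j.+1%:R = b - 2 * j%:R - 2 by rewrite -natr1; ring.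
rewrite derive1nS derive1E.
have [_ <-] := @is_derive_powR_expRNV _ (b - 2 * j%:R) (rodrigues_factor b j) _ x0.
(* [IHj] covers only positive points, but these form a neighbourhood of [x]. *)
apply: near_eq_derive; near=> y; apply: IHj; near: y; exact: lt_nbhsr.
Unshelve. all: by end_near. Qed.

(** The difference vanishes at 1, 2, ..., [size (p - q)], more roots than its degree allows unless
    it is zero. *)
Lemma horner_inj_pos (R : realDomainType) (p q : {poly R}) :
  (forall x, 0 < x -> p.[x] = q.[x]) -> p = q.
Proof.
move=> pq; apply/eqP; rewrite -subr_eq0; apply/eqP.
apply: (@roots_geq_poly_eq0 _ _ [seq i.+1%:R | i <- iota 0 (size (p - q))]).
- apply/allP => _ /mapP[i _ ->].
  by rewrite rootE hornerD hornerN pq ?subrr ?ltr0n.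
- by rewrite map_inj_uniq ?iota_uniq // => i j /eqP; rewrite eqr_nat => /eqP[].
- by rewrite size_map size_iota.
Qed.

Lemma NpolyE (R : realType) (n : nat) (p : R) :
  Npoly n p = (- 1) ^+ n *: rodrigues_factor (- p + 2 * n%:R) n.
Proof.
have NP x : 0 < x -> ((- 1) ^+ n *: rodrigues_factor (- p + 2 * n%:R) n).[x]
    = rodrigues n p x.
  (* The exponent left after n derivatives is -p, so the prefactor x^p cancels it. *)
  move=> x0; rewrite hornerZ /rodrigues derive1n_powR_expRNV// addrK expRN powRN.
  by field; rewrite !gt_eqF ?expR_gt0 ?powR_gt0.
apply: xget_unique => [//|q qP].
by apply: horner_inj_pos => x x0; rewrite qP // NP.
Qed.

(** Put c = (k+1)(k+2-q). As g_(k+1)' = c g_k, the left side is, up to sign, c (x^2 g_k' + (2-q) x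
    g_k), which the recursion turns into c (g_(k+1) - g_k). *)
Lemma Npoly_ode (R : realType) (k : nat) (q : R) :
  'X^2 * (Npoly k.+1 q)^`()^`() + (2 - q)%:P * 'X * (Npoly k.+1 q)^`()
    = (k.+1%:R * (k.+2%:R - q))%:P * (Npoly k.+1 q + Npoly k (q - 2)).
Proof.
rewrite !NpolyE.
have -> : - (q - 2) + 2 * k%:R = - q + 2 * k.+1%:R by rewrite -natr1; ring.
set b := - q + 2 * k.+1%:R; set g := rodrigues_factor b.
have gS : g k.+1 = (1 + (2 - q)%:P * 'X) * g k + 'X^2 * (g k)^`().
  by rewrite /g /= /b -natr1; congr ((1 + _%:P * _) * _ + _); ring.
have dg : (g k.+1)^`() = (k.+1%:R * (k.+2%:R - q))%:P * g k.
  by rewrite /g deriv_rodrigues_factor /b -!natr1; congr (_%:P * _); ring.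
rewrite !derivZ dg derivM derivC mul0r add0r gS -!mul_polyC.
by rewrite [(-1) ^+ k.+1]exprS mulN1r polyCN !polyCM; ring.
Qed.

Lemma peval_homog (R : realType) (d m : nat) (q : mpoly d R) (a : R)
    (x : 'rV[R]_d) :
  q \is ishomog1 m mdeg -> peval q (a *: x) = a ^+ m * peval q x.
Proof.
move=> /dhomogP qm; rewrite /peval !mevalE mulr_sumr.
apply: eq_big_seq => mu /qm <-.
rewrite mulrCA [in a ^+ _]/= mdegE -prodrXr -big_split /=; congr (_ * _).
by apply: eq_bigr => i _; rewrite mxE exprMn.
Qed.

Lemma derive1_horner (R : realFieldType) (p : {poly R}) :
  derive1 (horner p) = horner p^`().
Proof. by apply/funext => x; rewrite derive1E derive_val. Qed.

Lemma mulX_derivXn (R : comNzRingType) (m : nat) :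
  'X * ('X^m)^`() = m%:R%:P * 'X^m :> {poly R}.
Proof.
rewrite derivXn mulrnAr -mulr_natl polyC_natr.
by case: m => [|m]; rewrite ?mul0r// -exprS.
Qed.

(** Applying the Euler operator twice gives m^2 X^m; subtracting one application leaves this. The
    coefficient m - 1 lives in the ring, so m = 0 is covered. *)
Lemma mulX2_deriv2Xn (R : comNzRingType) (m : nat) :
  'X^2 * ('X^m)^`()^`() = (m%:R * (m%:R - 1))%:P * 'X^m :> {poly R}.
Proof.
have := congr1 (fun q => 'X * q^`()) (mulX_derivXn R m).
rewrite /= !derivM derivX derivC mul0r add0r mul1r mulrDr mulX_derivXn.
rewrite [X in _ = X]mulrCA mulX_derivXn => XXm.
apply: (addrI (m%:R%:P * 'X^m)); rewrite expr2 -mulrA XXm.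
by rewrite rmorphM rmorphB; ring.
Qed.

(** The cross term of the Leibniz rule shifts a by 2m. *)
Lemma euler_mulXn (R : comNzRingType) (A : {poly R}) (a : R) (m : nat) :
  'X^2 * (A * 'X^m)^`()^`() + a%:P * 'X * (A * 'X^m)^`()
    = ('X^2 * A^`()^`() + (a + 2 * m%:R)%:P * 'X * A^`()
       + (m%:R * (m%:R - 1 + a))%:P * A) * 'X^m.
Proof.
have XD := mulX_derivXn R m; have X2D := mulX2_deriv2Xn R m.
rewrite !(derivM, derivD).
move: ('X^m) ('X^m)^`() ('X^m)^`()^`() XD X2D => V V' V'' XD X2D.
transitivity ('X^2 * A^`()^`() * V + 2 * ('X * A^`()) * ('X * V')
  + A * ('X^2 * V'') + a%:P * ('X * A^`() * V + A * ('X * V'))); first by ring.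
by rewrite XD X2D !(rmorphM, rmorphD, rmorphB) /= !rmorph_nat; ring.
Qed.

Theorem theorem3p12 (R : realType) (d n m N : nat) (p : R)
    (Y : 'I_N -> mpoly d R) (l : 'I_N) (xi : 'rV[R]_d) (t : R)
    (hd : (2 <= d)%N) (hmn : (m <= n)%N) (hp : 2 * n%:R + d%:R < p)
    (hY : harmonic_orthonormal_basis m Y)
    (hxi : enorm xi = 1) (ht : 0 <= t) :
  let S := cone_coord (coneS p n m (Y l)) xi in
  t ^+ 2 * derive1n 2 S t + (1 - p + d%:R) * t * derive1 S t =
  n%:R * (n%:R - p + d%:R) * S t +
  (if m == n then 0
   else (m%:R - n%:R) * (p - n%:R - m%:R - d%:R) *
        cone_coord (coneS (p - 2) n.-1 m (Y l)) xi t).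
Proof.
have [/(_ l)[Yhom _] _ _] := hY.
set c := peval (Y l) xi.
have coneE p' n' : cone_coord (coneS p' n' m (Y l)) xi
    = horner (Npoly (n' - m) (p' - 2 * m%:R - d%:R + 1) * 'X^m * c%:P).
  by apply/funext => s; rewrite /cone_coord /coneS (peval_homog _ _ _ _ _ _ Yhom) !(hornerE, hornerXn) -/c.
move=> S; rewrite /S !coneE derive1Sn derive1n1 !derive1_horner.
have derivMC F : (F * c%:P)^`() = F^`() * c%:P.
  by rewrite derivM derivC mulr0 addr0.
rewrite !derivMC.
set q := p - 2 * m%:R - d%:R + 1.
set A := Npoly (n - m) q.
have /(congr1 (fun F => (F * c%:P).[t])) := euler_mulXn _ A (1 - p + d%:R) m.
have -> : 1 - p + d%:R + 2 * m%:R = 2 - q by rewrite /q; ring.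
rewrite mulrDl hornerD -!mulrA !(hornerM, hornerD, hornerC, hornerX, hornerXn) !mulrA.
move=> ->; rewrite /A {A}; have [mn|mn] := eqVneq m n.
  (* Here the [Npoly] factor is 1, and only the constant m (m - p + d) from [euler_mulXn]
     remains. *)
  rewrite mn subnn NpolyE /= expr0 scale1r !derivC !horner0 hornerC; ring.
have [k nE] : exists k, n = (m + k.+1)%N.
  by exists (n - m).-1; rewrite prednK ?subnKC// subn_gt0 ltn_neqAle mn.
have -> : p - 2 - 2 * m%:R - d%:R + 1 = q - 2 by rewrite /q; ring.
have -> : (n - m)%N = k.+1 by rewrite nE addKn.
have -> : (n.-1 - m)%N = k by rewrite nE addnS addKn.
have := congr1 (horner^~ t) (Npoly_ode _ k q).
rewrite !(hornerM, hornerD, hornerC, hornerX, hornerXn) => ->.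
(* The coefficient from [Npoly_ode] is (n-m)(n+m-p+d); adding m (m-p+d) gives n (n-p+d). *)
by rewrite nE natrD /q -!natr1; ring.
Qed.
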